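(* For every integer $d\ge 2$, the sequence $(p_{d^k})_{k=1}^{\infty}$ converges (to some limit $p^*(d)$), where for an integer $m\ge2$, $p_m=\inf\{p\in[0,1]:\mathrm{FM}(m,p)\text{ is recurrent}\}$ is the critical drift of the one-per-site frog model with drift on the rooted $m$-ary tree.
   Context: $\mathbb T_d$ is the rooted $d$-ary tree: the infinite tree in which every vertex has exactly $d$ children, with root $\varnothing$. The one-per-site frog model with drift $\mathrm{FM}(d,p)$, $p\in[0,1]$: initially there is one awake frog at the root and one sleeping frog at each non-root vertex of $\mathbb T_d$. At each time step every awake frog, independently, moves as follows: from a non-root vertex it moves to the parent vertex (towards the root) with probability $p$, and otherwise (with probability $1-p$) moves to a uniformly sampled child vertex; from the root it always moves to a uniformly sampled child. Sleeping frogs do not move. Whenever an awake frog visits a site with a sleeping frog, that sleeping frog wakes up and begins its own independent $p$-biased random walk of the same kind. $V(d,p)$ is the total number of visits to the root by awake frogs. $\mathrm{FM}(d,p)$ is recurrent if $V(d,p)=\infty$ almost surely. *)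

(* Defs.v *)
From mathcomp Require Import all_boot all_order all_algebra.
From mathcomp Require Import all_classical all_reals all_analysis.

Set Implicit Arguments.
Unset Strict Implicit.
Unset Printing Implicit Defensive.

Import Order.TTheory GRing.Theory Num.Theory.

Local Open Scope classical_set_scope.
Local Open Scope ring_scope.

(* Vertices of the rooted d-ary tree are words over {0, ..., d-1}, most recent
   letter first: the root is [::], the children of u are the i :: u, and the
   parent of i :: u is u. *)
Definition vertex (d : nat) : choiceType := seq 'I_d.

Definition is_child (d : nat) (u w : vertex d) : bool :=
  if w is _ :: w' then w' == u else false.

(* One-step transition probability from u to w of the p-biased walk. *)
Definition step_prob (R : realType) (d : nat) (p : R) (u w : vertex d) : R :=
  match u with
  | [::] => if is_child u w then d%:R^-1 else 0
  | _ :: parent =>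
      if w == parent then p
      else if is_child u w then (1 - p) / d%:R else 0
  end.

Section Process.
Context {disp : measure_display} {T : measurableType disp} {R : realType}.
Variable P : probability T R.

(* Mutual independence of a family of classes of events, to be applied to
   sigma-algebras. *)
Definition mutually_independent (I : eqType) (F : I -> set (set T)) : Prop :=
  forall (s : seq I) (A : I -> set T), uniq s ->
    (forall i, i \in s -> F i (A i)) ->
    P (\bigcap_(i in [set` s]) A i) = (\prod_(i <- s) fine (P (A i)))%:E.

Variable d : nat.

Definition walk_sigma_algebra (S : nat -> T -> vertex d) : set (set T) :=
  <<s [set A | exists n u, A = [set x | S n x = u]] >>.

(* S is a (measurable) Markov chain started at v with kernel [step_prob p]. *)
Definition biased_walk (p : R) (v : vertex d) (S : nat -> T -> vertex d) :
    Prop :=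
  (forall n u, measurable [set x | S n x = u]) /\
  (forall (n : nat) (w : nat -> vertex d),
     P [set x | forall k, (k <= n)%N -> S k x = w k] =
     ((w 0%N == v)%:R * \prod_(k < n) step_prob p (w k) (w k.+1))%:E).

(* [S v k x] is the position of the frog initially at v after it has made k
   moves, counted from the time at which it wakes up. *)
Definition frog_walks (p : R) (S : vertex d -> nat -> T -> vertex d) : Prop :=
  (forall v, biased_walk p v (S v)) /\
  mutually_independent (fun v => walk_sigma_algebra (S v)).

End Process.

Section Dynamics.
Variables (d : nat) (path : vertex d -> nat -> vertex d).

(* [moves t v] is [None] if the frog initially at v is asleep at time t, and
   [Some k] if it is awake and has made k moves. A frog woken at time t makes
   its first move between times t and t+1. *)
Fixpoint moves (t : nat) : vertex d -> option nat :=
  match t with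
  | 0%N => fun v => if v == [::] then Some 0%N else None
  | t'.+1 => fun v =>
      match moves t' v with
      | Some k => Some k.+1
      | None =>
          if `[< exists u k, moves t' u = Some k /\ path u k.+1 = v >]
          then Some 0%N else None
      end
  end.

Definition root_visits : set (nat * vertex d) :=
  [set tv | exists k, moves tv.1 tv.2 = Some k /\ path tv.2 k = [::]].

(* The initial presence of the first frog at the root counts as a visit; this
   does not affect whether the total is infinite. *)
Definition total_root_visits (R : realType) : \bar R := counting root_visits.

End Dynamics.

(* FM(d, p) is only specified in law, so the almost sure statement is required
   of every family of frog walks, on every probability space. *)
Definition recurrent (R : realType) (d : nat) (p : R) : Prop :=
  forall (disp : measure_display) (T : measurableType disp)
    (P : probability T R) (S : vertex d -> nat -> T -> vertex d),
    frog_walks P p S ->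
    {ae P, forall x, total_root_visits (fun v k => S v k x) R = +oo%E}.

Definition critical_drift (R : realType) (d : nat) : R :=
  inf [set p : R | 0 <= p <= 1 /\ recurrent d p].

(* Main.v *)
Require Import Defs.
From mathcomp Require Import all_boot all_order all_algebra.
From mathcomp Require Import all_classical all_reals all_analysis.
Import Order.TTheory GRing.Theory Num.Theory.
Import numFieldNormedType.Exports.
Local Open Scope classical_set_scope.
Local Open Scope ring_scope.

Set Implicit Arguments.
Unset Strict Implicit.
Unset Printing Implicit Defensive.

(** Recurrence of FM(b, p) implies recurrence of FM(c b, p) ([recurrent_mul]).
    Hence the sets of recurrent drifts increase along the powers of [d], and the
    infima of an increasing sequence of sets of nonnegative numbers converge
    ([increasing_sets_inf_cvg]).

    The implication is a coupling. Let [a = c * b] and let [q] map the [a]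
    letters onto the [b] letters with all fibres of size [c]. Applied letterwise,
    [q] projects the [a]-ary tree onto the [b]-ary tree, and the projection of a
    biased walk is a biased walk with the same drift ([project_biased_walk]).
    Many frogs of the [a]-ary tree lie above one site of the [b]-ary tree; keep
    only one of them, namely the first one discovered by an exploration that
    follows only the frogs kept so far. A frog is kept before its trajectory has
    been looked at, and all frogs above a site have the same projected law, so
    the projected trajectories of the kept frogs are independent biased walks
    ([limit_selected_frog_walks]): on the same probability space they form a copy
    of FM(b, p). Every kept frog is awake in the [a]-ary tree, and every site
    that awakes in the [b]-ary tree has a kept frog, so infinitely many visits to
    the root of the [b]-ary tree force infinitely many visits to the root of the
    [a]-ary tree ([projected_root_visits]).

    Whether a frog ever wakes up, and how often it then visits the root, does not
    depend on the order in which the frogs move. The exploration may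
    therefore test one candidate vertex per step in a deterministic order that
    returns to each vertex infinitely often, which makes every step change the
    frog kept at a single, non-random site. The law of the kept family is then
    shown to be invariant under each step ([selected_exchange]). *)

(** * Independence *)

Section Independence.
Context {disp : measure_display} {T : measurableType disp} {R : realType}.
Variable P : probability T R.
Local Open Scope ereal_scope.

Lemma indep_pi_system (A : set T) (G : set (set T)) :
  measurable A -> G `<=` measurable -> setI_closed G -> G setT ->
  (forall B, G B -> P (A `&` B) = P A * P B) ->
  forall B, <<s G >> B -> P (A `&` B) = P A * P B.
Proof.
move=> mA mG IG GT indep B sB.
have PAE : (fine (P A))%:E = P A by rewrite fineK// fin_num_measure.
have PA0 : (0 <= fine (P A))%R by exact: fine_ge0.
pose m1 : {measure set T -> \bar R} := mrestr P mA.
pose m2 : {measure set T -> \bar R} := mscale (NngNum PA0) P.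
suff : m1 B = m2 B by rewrite /m1 /m2 /= /mrestr /mscale /= PAE setIC.
apply: (g_sigma_algebra_measure_unique G mG (fun=> setT)) => //.
- by apply/seteqP; split => // x _; exists 0%N.
- by move=> C GC; rewrite /m1 /m2 /= /mrestr /mscale /= PAE setIC indep.
- move=> _; rewrite /m1 /= /mrestr setTI.
  by rewrite ltey_eq fin_num_measure.
Qed.

(** The finite intersections of events of the families indexed by [J] form a
    pi-system generating the joint sigma-algebra. *)
Lemma indep_block (I : choiceType) (F : I -> set (set T)) (J : set I) (i : I) :
  (forall j, F j `<=` measurable) -> (forall j, F j setT) ->
  (forall j, setI_closed (F j)) -> mutually_independent P F -> ~ J i ->
  forall A B, F i A -> <<s \bigcup_(j in J) F j >> B ->
  P (A `&` B) = P A * P B.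
Proof.
move=> mF FT FI indF nJi A B FA.
pose G : set (set T) := [set C | exists (s : seq I) (E : I -> set T),
  [/\ uniq s, forall j, j \in s -> J j, forall j, F j (E j) &
      C = \bigcap_(j in [set` s]) E j]].
have subG : \bigcup_(j in J) F j `<=` G.
  move=> C [j Jj FC]; exists [:: j], (fun k => if k == j then C else setT).
  split=> //.
  - by move=> k; rewrite inE => /eqP ->.
  - by move=> k; case: eqP => [->|].
  - apply/seteqP; split => [x Cx k /=|x /(_ j)/=].
      by rewrite inE => /eqP ->; rewrite eqxx.
    by rewrite eqxx inE eqxx; apply.
move=> sB; have {sB} : <<s G >> B by exact: sub_sigma_algebra2 sB.
apply: indep_pi_system.
- exact: mF FA.
- move=> C [s [E [us sJ FE ->]]].
  by apply: fin_bigcap_measurable => // j _; exact: mF.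
- move=> _ _ [s [E [us sJ FE ->]]] [s' [E' [us' sJ' FE' ->]]].
  exists (undup (s ++ s')), (fun j => (if j \in s then E j else setT)
    `&` (if j \in s' then E' j else setT)); split.
  + exact: undup_uniq.
  + by move=> j; rewrite mem_undup mem_cat => /orP[/sJ|/sJ'].
  + by move=> j; apply: FI; case: ifP.
  + apply/seteqP; split => [x [Ex E'x] j /= _|x Ex].
      by split; [case: ifP => [/Ex|]|case: ifP => [/E'x|]].
    by split=> j /= js; have := Ex j;
      rewrite /= mem_undup mem_cat js ?orbT => /(_ isT)[].
- by exists [::], (fun=> setT); split=> //; apply/seteqP; split.
- move=> _ [s [E [us sJ FE ->]]].
  have nis : i \notin s by apply/negP => /sJ.
  pose E' j := if j == i then A else E j.
  have E'E j : j \in s -> E' j = E j.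
    by move=> js; rewrite /E'; case: eqP js nis => // -> ->.
  have FE' j : F j (E' j) by rewrite /E'; case: eqP => [->|].
  have -> : A `&` \bigcap_(j in [set` s]) E j
            = \bigcap_(j in [set` i :: s]) E' j.
    apply/seteqP; split => [x [Ax Ex] j /=|x E'x].
      by rewrite inE => /predU1P[->|js]; [rewrite /E' eqxx|rewrite E'E//; exact: Ex].
    split; first by have := E'x i; rewrite /= mem_head /E' eqxx; apply.
    by move=> j /= js; rewrite -E'E//; apply: E'x; rewrite /= inE js orbT.
  rewrite (indF (i :: s) E') /= ?nis// (indF s E)//.
  rewrite big_cons EFinM /E' eqxx fineK ?fin_num_measure//; last exact: mF FA.
  by congr (_ * (_)%:E); apply: eq_big_seq => j /E'E; rewrite /E' => ->.
Qed.

(** The sets of points that lie in all [A n] from some index on increase to [B],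
    which bounds the probability of [B] by [c]; the same bound for the complement
    gives equality. *)
Lemma eventually_constant_prob (A : nat -> set T) (B : set T) (c : \bar R) :
  (forall n, measurable (A n)) ->
  (forall x, exists N, forall n, (N <= n)%N -> A n x <-> B x) ->
  (forall n, P (A n) = c) -> measurable B /\ P B = c.
Proof.
move=> mA AB PA.
have half (E : nat -> set T) (C : set T) (a : \bar R) :
    (forall n, measurable (E n)) ->
    (forall x, exists N, forall n, (N <= n)%N -> E n x <-> C x) ->
    (forall n, P (E n) = a) -> measurable C /\ P C <= a.
  move=> mE EC PE; pose U n := \bigcap_(m in [set m | (n <= m)%N]) E m.
  have mU n : measurable (U n) by exact: bigcap_measurableType.
  have ndU : nondecreasing_seq U.
    move=> m n mn; apply/subsetPset => x Ux k /= nk; apply: Ux => /=.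
    exact: leq_trans nk.
  have UC : \bigcup_n U n = C.
    apply/seteqP; split=> [x [n _ Ux]|x Cx].
      have [N EN] := EC x; apply/(EN (maxn N n)); first exact: leq_maxl.
      by apply: Ux; exact: leq_maxr.
    have [N EN] := EC x; exists N => // m /= Nm; exact/EN.
  have mC : measurable C by rewrite -UC; exact: bigcupT_measurable.
  split=> //; rewrite -UC.
  have := nondecreasing_cvg_mu (mu := P) mU _ ndU; rewrite UC => /(_ mC) cv.
  rewrite -(cvg_lim _ cv)//; apply: lime_le; first by apply/cvg_ex; exists (P C).
  apply: nearW => n /=; rewrite -(PE n); apply: le_measure; rewrite ?inE//.
  by apply: bigcap_inf => /=.
have [mB Bc] := half A B c mA AB PA; split => //.
apply/eqP; rewrite eq_le Bc /=.
have [||n|_] := half (fun n => ~` A n) (~` B) (1 - c).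
- by move=> n; exact: measurableC.
- move=> x; have [N EN] := AB x; exists N => n Nn.
  by split=> nA /(EN n Nn).
- by rewrite probability_setC// PA.
have cfin : c \is a fin_num by rewrite -(PA 0%N) fin_num_measure.
rewrite probability_setC// -(fineK cfin) -(fineK (fin_num_measure P B mB)).
by rewrite -!EFinB !lee_fin lerD2l lerN2.
Qed.

End Independence.

(** * Laws of trajectories *)

Section Trajectories.
Context {disp : measure_display} {T : measurableType disp} {R : realType}.
Variable P : probability T R.
Variable d : nat.
Implicit Types X : nat -> T -> vertex d.

Definition cylinders : set (set (nat -> vertex d)) :=
  [set B | exists n u, B = [set f | f n = u]].

Definition trajectory X (x : T) : nat -> vertex d := fun n => X n x.

Lemma trajectory_preimage X (B : set (nat -> vertex d)) :
  <<s cylinders >> B -> walk_sigma_algebra X (trajectory X @^-1` B).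
Proof.
pose M := image_set_system setT (trajectory X) (walk_sigma_algebra X).
suff : <<s cylinders >> `<=` M by move=> sub /sub; rewrite /M /image_set_system /= setTI.
apply: smallest_sub.
  exact/sigma_algebra_image/smallest_sigma_algebra.
move=> _ [n [u ->]]; rewrite /M /image_set_system /= setTI.
by apply: sub_sigma_algebra; exists n, u.
Qed.

Lemma walk_sigma_algebra_preimage X (A : set T) :
  walk_sigma_algebra X A ->
  exists2 B, <<s cylinders >> B & A = trajectory X @^-1` B.
Proof.
have : walk_sigma_algebra X
    `<=` preimage_set_system setT (trajectory X) <<s cylinders >>.
  apply: smallest_sub.
    exact/sigma_algebra_preimage/smallest_sigma_algebra.
  move=> _ [n [u ->]]; exists [set f | f n = u]; last by rewrite setTI.
  by apply: sub_sigma_algebra; exists n, u.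
by move=> sub /sub [B mB <-]; exists B => //; rewrite setTI.
Qed.

Lemma walk_sigma_algebra_measurable X :
  (forall n u, measurable [set x | X n x = u]) ->
  walk_sigma_algebra X `<=` measurable.
Proof.
move=> mX; apply: smallest_sub; first exact: sigma_algebra_measurable.
by move=> _ [n [u ->]].
Qed.

Lemma walk_sigma_algebraI X : setI_closed (walk_sigma_algebra X).
Proof. exact: (@measurableI _ (g_sigma_algebraType _)). Qed.

Lemma walk_sigma_algebraT X : walk_sigma_algebra X setT.
Proof. exact: (@measurableT _ (g_sigma_algebraType _)). Qed.

(** There are only countably many prefixes of given length. *)
Lemma prefixes_generate_cylinders (G : set (set (nat -> vertex d))) :
  (forall n (w : nat -> vertex d), G [set f | forall k, (k <= n)%N -> f k = w k]) ->
  G set0 -> <<s cylinders >> `<=` <<s G >>.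
Proof.
move=> Gw G0; apply: smallest_sub; first exact: smallest_sigma_algebra.
move=> _ [n [u ->]].
pose F m : set (nat -> vertex d) :=
  if unpickle m is Some s then
    if nth [::] s n == u :> seq 'I_d
    then [set f | forall k, (k <= n)%N -> f k = nth [::] s k] else set0
  else set0.
suff -> : [set f | f n = u] = \bigcup_m F m.
  apply: sigma_algebra_bigcup => m; apply: sub_sigma_algebra; rewrite /F.
  by case: unpickle => [s|//]; case: ifP.
apply/seteqP; split => [f fn|f [m _]].
  exists (pickle (mkseq f n.+1 : seq (seq 'I_d))) => //.
  rewrite /F pickleK nth_mkseq// fn eqxx => k kn.
  by rewrite nth_mkseq.
by rewrite /F; case: unpickle => [s|//]; case: eqP => // <-; apply.
Qed.

(** The finite prefixes form a pi-system, so they determine the law of a walk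
    on all events of its trajectory. *)
Lemma same_prefix_law X X' :
  (forall n u, measurable [set x | X n x = u]) ->
  (forall n u, measurable [set x | X' n x = u]) ->
  (forall n (w : nat -> vertex d),
     P [set x | forall k, (k <= n)%N -> X k x = w k] =
     P [set x | forall k, (k <= n)%N -> X' k x = w k]) ->
  forall B, <<s cylinders >> B ->
  P (trajectory X @^-1` B) = P (trajectory X' @^-1` B).
Proof.
move=> mX mX' XX'.
have mpre Y : (forall n u, measurable [set x | Y n x = u]) ->
    forall B, <<s cylinders >> B -> measurable (trajectory Y @^-1` B).
  move=> mY B /(trajectory_preimage (X := Y)).
  exact: walk_sigma_algebra_measurable.
pose G : set (set (nat -> vertex d)) := [set B | B = set0 \/
  exists n (w : nat -> vertex d), B = [set f | forall k, (k <= n)%N -> f k = w k]].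
have sG : <<s cylinders >> `<=` <<s G >>.
  by apply: prefixes_generate_cylinders => [n w|]; [right; exists n, w|left].
have mG Y : (forall n u, measurable [set x | Y n x = u]) ->
    forall B, G B -> measurable (trajectory Y @^-1` B).
  move=> mY _ [->|[n [w ->]]]; first by rewrite preimage_set0.
  rewrite (_ : _ @^-1` _ =
    \bigcap_(k in [set k | (k <= n)%N]) [set x | Y k x = w k]) //.
  exact: bigcap_measurableType.
pose H : set (set (nat -> vertex d)) := [set B |
  [/\ measurable (trajectory X @^-1` B), measurable (trajectory X' @^-1` B) &
      P (trajectory X @^-1` B) = P (trajectory X' @^-1` B)]].
suff : <<s G >> `<=` H by move=> GH B /sG /GH [].
apply: lambda_system_subset => //.
- have GI n (w : nat -> vertex d) n' (w' : nat -> vertex d) : (n <= n')%N ->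
      G ([set f | forall k, (k <= n)%N -> f k = w k] `&`
         [set f | forall k, (k <= n')%N -> f k = w' k]).
    move=> nn'; have [ww'|/existsNP[k]] :=
      pselect (forall k, (k <= n)%N -> w k = w' k).
      right; exists n', w'; apply/seteqP; split=> [f [_ //]|f fw'].
      by split => // k kn; rewrite ww'// fw'// (leq_trans kn).
    move=> /not_implyP[kn wk]; left; apply/seteqP; split => // f [fw fw'].
    by apply: wk; rewrite -fw// fw'// (leq_trans kn).
  move=> _ _ [->|[n [w ->]]] [->|[n' [w' ->]]]; try by left; rewrite ?setI0 ?set0I.
  have [nn'|/ltnW n'n] := leqP n n'; first exact: GI.
  by rewrite setIC; exact: GI.
- apply/dynkin_lambda_system; split.
  + by split; rewrite preimage_setT.
  + move=> B [mB mB' PB]; split; rewrite preimage_setC; [exact: measurableC..|].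
    by rewrite !probability_setC// PB.
  + move=> F tF HF.
    have mF n : measurable (trajectory X @^-1` F n) by case: (HF n).
    have mF' n : measurable (trajectory X' @^-1` F n) by case: (HF n).
    have tpre Y : trivIset setT (fun n => trajectory Y @^-1` F n).
      move=> i j _ _ [x [Fi Fj]]; apply: tF => //.
      by exists (trajectory Y x).
    split; rewrite preimage_bigcup; [exact: bigcupT_measurable..|].
    rewrite (measure_bigcup P setT _ (fun n _ => mF n) (tpre X)).
    rewrite (measure_bigcup P setT _ (fun n _ => mF' n) (tpre X')).
    by apply: eq_eseriesr => n _; case: (HF n).
- move=> B GB; split; [exact: mG..|].
  case: GB => [->|[n [w ->]]]; first by rewrite !preimage_set0.
  exact: XX'.
Qed.

End Trajectories.
Arguments cylinders {d}.

(** * Projection of a biased walk *)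

Section Lumping.
Context {disp : measure_display} {T : measurableType disp} {R : realType}.
Variable P : probability T R.

Lemma prob_partition (I : choiceType) (s : seq I) (A : set T) (E : I -> set T) :
  uniq s -> measurable A -> (forall i, measurable (E i)) ->
  trivIset setT E -> A `<=` \bigcup_(i in [set` s]) E i ->
  P A = (\sum_(i <- s) P (A `&` E i))%E.
Proof.
move=> us mA mE tE AE.
rewrite -[in LHS](setIidl AE) setI_bigcupr measure_fin_bigcup//.
- by rewrite -fsbig_seq.
- move=> i j _ _ [x [[_ Ei] [_ Ej]]]; apply: tE => //; by exists x.
- by move=> i _; exact: measurableI.
Qed.

(** Both kinds of moves, towards the root and to a child, are written as sums of
    point masses, which project termwise. *)
Lemma step_prob_sum (d : nat) (p : R) (u w : vertex d) :
  step_prob p u w = (if u is _ :: v then p * (w == v)%:R else 0)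
  + \sum_(i < d) (if u is [::] then 1 else 1 - p) / d%:R
      * (w == i :: u :> seq 'I_d)%:R.
Proof.
have childE : \sum_(i < d) (w == i :: u :> seq 'I_d)%:R
    = (is_child u w)%:R :> R.
  case: w => [|j w] /=; first by rewrite big1.
  rewrite (bigD1 j)//= eqseq_cons eqxx big1 ?addr0// => i ij.
  by rewrite eqseq_cons eq_sym (negbTE ij).
rewrite -mulr_sumr childE; case: u {childE} => [|i v] /=.
  by rewrite add0r mul1r; case: is_child; rewrite ?mulr1 ?mulr0.
have [->|_] := eqVneq w v; last first.
  by rewrite mulr0 add0r; case: is_child; rewrite ?mulr1 ?mulr0.
suff -> : is_child (i :: v : vertex d) v = false by rewrite mulr1 mulr0 addr0.
case: v => // j v /=; apply/negP => /eqP/(congr1 size)/= /eqP.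
by rewrite -[X in X == _]addn0 -addn2 eqn_add2l.
Qed.

Variables (a b c : nat) (q : 'I_a -> 'I_b).
Hypothesis c_gt0 : (0 < c)%N.
Hypothesis fibreq : forall j, #|[pred i | q i == j]| = c.

Fixpoint lifts (u : vertex b) : seq (seq 'I_a) :=
  if u is j :: v
  then [seq i :: z | i <- enum [pred i | q i == j], z <- lifts v] else [:: [::]].

Lemma mem_lifts (u : vertex b) (z : vertex a) :
  (z \in lifts u) = (map q z == u :> seq 'I_b).
Proof.
elim: u z => [|j u IHu] [|i z] //=.
- by apply/allpairsP => -[[i z] [_ _]].
- rewrite eqseq_cons -IHu; apply/allpairsP/andP => [[[i' z'] /= [qi zu]]|].
    by move=> [-> ->]; rewrite mem_enum inE in qi.
  by move=> [qi zu]; exists (i, z); rewrite mem_enum inE.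
Qed.

Lemma lifts_uniq (u : vertex b) : uniq (lifts u).
Proof.
elim: u => //= j u IHu; apply: allpairs_uniq => //; first exact: enum_uniq.
by move=> [i z] [i' z'] _ _ /= [-> ->].
Qed.

Lemma sum_lifts (u : vertex b) (y : vertex a) :
  \sum_(z <- lifts u) (z == y :> seq 'I_a)%:R
  = (u == map q y :> seq 'I_b)%:R :> R.
Proof.
rewrite -natr_sum; congr (_%:R).
rewrite (eq_sym u) -mem_lifts -count_uniq_mem ?lifts_uniq// -sum1_count.
by rewrite [RHS]big_mkcond; apply: eq_bigr => z _ /=; case: (z == y).
Qed.

Lemma fibre_average (f : 'I_b -> R) :
  \sum_(i < a) a%:R^-1 * f (q i) = \sum_(j < b) b%:R^-1 * f j.
Proof.
have aE : a = (b * c)%N.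
  rewrite -[LHS]card_ord -sum1_card (partition_big q predT)//=.
  rewrite (eq_bigr (fun=> c)) ?sum_nat_const ?card_ord// => j _.
  by rewrite sum1_card fibreq.
rewrite -!mulr_sumr (partition_big q predT)//=.
rewrite (eq_bigr (fun j => c%:R * f j)) => [|j _]; last first.
  rewrite (eq_bigr (fun=> f j)) => [|i /eqP -> //].
  by rewrite sumr_const fibreq mulr_natl.
by rewrite -mulr_sumr aE natrM invfM mulrA divfK// pnatr_eq0 -lt0n.
Qed.

(** A letter map with fibres of constant size makes the projected walk
    Markovian, with the transition probabilities of the biased walk. *)
Lemma step_prob_lumping (p : R) (z : vertex a) (u : vertex b) :
  \sum_(y <- lifts u) step_prob p z y = step_prob p (map q z : vertex b) u.
Proof.
under eq_bigr do rewrite step_prob_sum.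
rewrite step_prob_sum big_split /= exchange_big /=; congr (_ + _).
  case: z => [|i z] /=; first by rewrite big1.
  by rewrite -mulr_sumr sum_lifts.
under eq_bigr do rewrite -mulr_sumr sum_lifts -mulrA /=.
under [RHS]eq_bigr do rewrite -mulrA /=.
rewrite -[LHS]mulr_sumr -[RHS]mulr_sumr; congr (_ * _); first by case: z.
exact: (fibre_average (fun j => (u == j :: map q z :> seq 'I_b)%:R)).
Qed.

Definition project (X : nat -> T -> vertex a) : nat -> T -> vertex b :=
  fun n x => map q (X n x).

Lemma project_measurable (X : nat -> T -> vertex a) :
  (forall n u, measurable [set x | X n x = u]) ->
  forall n u, measurable [set x | project X n x = u].
Proof.
move=> mX n u.
rewrite (_ : [set x | _] =
    \bigcup_(z in [set` lifts u : seq (seq 'I_a)]) [set x | X n x = z]).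
  by apply: fin_bigcup_measurable.
apply/seteqP; split=> [x /= Xu|x [z /= zu Xz]].
  by exists (X n x) => //=; rewrite mem_lifts; apply/eqP.
by move: zu; rewrite -Xz mem_lifts => /eqP.
Qed.

(** Fixing the first [j] steps exactly and the next [m] steps only through their
    projection makes an induction on [m] possible: splitting on the exact position
    after step [j.+1] turns one projected constraint into an exact one. *)
Lemma biased_walk_then_projection (p : R) (v : vertex a)
    (X : nat -> T -> vertex a) : biased_walk P p v X ->
  forall m j (w : nat -> vertex a) (u : nat -> vertex b),
  u 0%N = map q (w j) ->
  P [set x | (forall k, (k <= j)%N -> X k x = w k) /\
             (forall k, (k <= m)%N -> project X (j + k) x = u k)]
  = ((w 0%N == v)%:R * \prod_(k < j) step_prob p (w k) (w k.+1)
     * \prod_(k < m) step_prob p (u k) (u k.+1))%:E.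
Proof.
move=> [mX PX]; elim=> [|m IHm] j w u uw.
  rewrite big_ord0 mulr1 -PX; congr (P _).
  apply/seteqP; split=> [x []//|x Xw]; split=> // k; rewrite leqn0 => /eqP ->.
  by rewrite /project addn0 uw Xw.
set A := [set x | _].
have mA : measurable A.
  rewrite (_ : A = (\bigcap_(k in [set k | (k <= j)%N]) [set x | X k x = w k])
    `&` (\bigcap_(k in [set k | (k <= m.+1)%N])
          [set x | project X (j + k) x = u k])) //.
  apply: measurableI; apply: bigcap_measurableType => k _; first exact: mX.
  exact: project_measurable.
rewrite (prob_partition (s := lifts (u 1%N)) (E := fun z => [set x | X j.+1 x = z])).
- pose w' (z : seq 'I_a) k := if k == j.+1 then z else w k.
  have PA z : z \in lifts (u 1%N) -> P (A `&` [set x | X j.+1 x = z])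
      = ((w 0%N == v)%:R * \prod_(k < j) step_prob p (w k) (w k.+1)
         * \prod_(k < m) step_prob p (u k.+1) (u k.+2)
         * step_prob p (w j) z)%:E.
    rewrite mem_lifts => /eqP zu.
    have := IHm j.+1 (w' z) (fun k => u k.+1).
    rewrite {1}/w' eqxx zu => /(_ erefl) PE.
    transitivity (P [set x | (forall k, (k <= j.+1)%N -> X k x = w' z k) /\
        (forall k, (k <= m)%N -> project X (j.+1 + k) x = u k.+1)]).
      congr (P _); apply/seteqP; split=> [x [[Xw Xu] Xz]|x [Xw Xu]].
        split=> [k|k km]; last by rewrite addSnnS Xu.
        by rewrite /w'; case: eqP => [->//|/eqP kj]; rewrite leq_eqVlt (negbTE kj); exact: Xw.
      have XE k : (k <= j)%N -> X k x = w k.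
        by move=> kj; rewrite Xw ?(leqW kj)// /w' ltn_eqF.
      split; last by rewrite /= Xw// /w' eqxx.
      split=> // -[_|k km]; first by rewrite /project addn0 XE// uw.
      by rewrite -addSnnS Xu.
    rewrite PE; congr (_%:E).
    rewrite big_ord_recr /= {1}/w' /= /w' eqxx ltn_eqF//.
    rewrite (eq_bigr (fun k : 'I_j => step_prob p (w k) (w k.+1))); last first.
      move=> k _; rewrite (ltn_eqF (leqW (ltn_ord k))).
      by rewrite (ltn_eqF (_ : k.+1 < j.+1)%N)// ltnS.
    by rewrite mulrA mulrAC.
  rewrite (eq_big_seq _ PA) sumEFin -mulr_sumr step_prob_lumping -uw.
  by rewrite big_ord_recl -!mulrA; congr (_ * (_ * _))%:E; rewrite mulrC.
- exact: lifts_uniq.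
- exact: mA.
- by move=> z; exact: mX.
- by move=> z z' _ _ [x [/= <- <-]].
- move=> x [_ /(_ 1%N)]; rewrite addn1 => /(_ isT) Xu.
  by exists (X j.+1 x) => //=; rewrite mem_lifts; apply/eqP.
Qed.

Lemma project_biased_walk (p : R) (v : vertex a) (X : nat -> T -> vertex a) :
  biased_walk P p v X -> biased_walk P p (map q v : vertex b) (project X).
Proof.
move=> wX; have [mX PX] := wX; split=> [|n u]; first exact: project_measurable.
set A := [set x | _].
have mA : measurable A.
  rewrite (_ : A = \bigcap_(k in [set k | (k <= n)%N])
    [set x | project X k x = u k]) //.
  by apply: bigcap_measurableType => k _; exact: project_measurable.
rewrite (prob_partition (s := lifts (u 0%N)) (E := fun z => [set x | X 0%N x = z])).
- have PA z : z \in lifts (u 0%N) -> P (A `&` [set x | X 0%N x = z])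
      = (\prod_(k < n) step_prob p (u k) (u k.+1)
         * (z == v :> seq 'I_a)%:R)%:E.
    rewrite mem_lifts => /eqP zu.
    have := @biased_walk_then_projection p v X wX n 0%N (fun=> z) u (esym zu).
    rewrite big_ord0 mulr1 mulrC => <-; congr (P _).
    apply/seteqP; split=> [x [Xu Xz]|x [Xz Xu]].
      by split=> // k; rewrite leqn0 => /eqP ->.
    by split; [exact: Xu|exact: Xz].
  by rewrite (eq_big_seq _ PA) sumEFin -mulr_sumr sum_lifts mulrC.
- exact: lifts_uniq.
- exact: mA.
- by move=> z; exact: mX.
- by move=> z z' _ _ [x [/= <- <-]].
- move=> x /(_ 0%N isT) Xu.
  by exists (X 0%N x) => //=; rewrite mem_lifts; apply/eqP.
Qed.

End Lumping.

(** * Waking times *)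

Section Wakefulness.
Variables (d : nat) (path : vertex d -> nat -> vertex d).

Lemma moves_addn t n v k :
  moves path t v = Some k -> moves path (t + n) v = Some (k + n)%N.
Proof.
by move=> tv; elim: n => [|n IHn]; rewrite ?addn0// !addnS /= IHn.
Qed.

Lemma moves_wake t v k : moves path t v = Some k ->
  exists2 t0, t = (t0 + k)%N & moves path t0 v = Some 0%N.
Proof.
elim: t k => [|t IHt] k /=.
  by case: eqP => // -> [<-]; exists 0%N => //=; rewrite eqxx.
case E: (moves path t v) => [k'|].
  by move=> [<-]; have [t0 -> t0v] := IHt _ E; exists t0; rewrite ?addnS.
case: asboolP => // wakes [<-]; exists t.+1; first by rewrite addn0.
by rewrite /= E asboolT.
Qed.

Lemma wake_unique t t' v :
  moves path t v = Some 0%N -> moves path t' v = Some 0%N -> t = t'.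
Proof.
wlog le_tt' : t t' / (t <= t')%N => [hwlog tv t'v|].
  by have [le|/ltnW le] := leqP t t'; [exact: hwlog|exact/esym/hwlog].
move=> /(@moves_addn _ (t' - t)); rewrite subnKC// => -> [] /eqP.
by rewrite add0n subn_eq0 => ge_tt'; apply/eqP; rewrite eqn_leq le_tt'.
Qed.

Lemma moves_visit t u k :
  moves path t u = Some k -> exists t', moves path t' (path u k.+1) = Some 0%N.
Proof.
move=> tu; have [n nE] : exists n, moves path t.+1 (path u k.+1) = Some n.
  rewrite /=; case: (moves path t _) => [n|]; first by exists n.+1.
  by rewrite asboolT; [exists 0%N|exists u, k].
by have [t' _] := moves_wake nE; exists t'.
Qed.

End Wakefulness.

(** * The exploration *)

Section Exploration.
Variables (a b : nat) (q : 'I_a -> 'I_b) (l : 'I_b -> 'I_a).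
Hypothesis lK : cancel l q.
Implicit Types (X : vertex a -> nat -> vertex a) (v : vertex b) (r w : vertex a).

(** Every number of the form [2 ^ pickle w * 3 ^ M] yields the vertex [w], so each
    vertex is a target infinitely often. *)
Definition target (N : nat) : vertex a :=
  odflt [::] (unpickle (logn 2 N) : option (seq 'I_a)).

Lemma target_recurs w M : exists2 N, (M <= N)%N & target N = w.
Proof.
exists (2 ^ pickle (w : seq 'I_a) * 3 ^ M)%N.
  apply: (leq_trans (ltnW (ltn_expl M (isT : 1 < 3)%N))).
  by rewrite leq_pmull// expn_gt0.
rewrite /target lognM ?expn_gt0// !lognX.
have [-> ->] : logn 2 2 = 1%N /\ logn 2 3 = 0%N by [].
by rewrite muln1 muln0 addn0 pickleK.
Qed.

(** No frog has yet been kept at the site below [w], and a kept frog visits [w] at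
    some positive time, however late. *)
Definition discovered X (ch : vertex b -> option (vertex a)) w : Prop :=
  ch (map q w) = None /\ exists v r k, ch v = Some r /\ X r k.+1 = w.

(** The frog of the larger tree kept at each site of the smaller tree after [N]
    steps of the exploration. *)
Fixpoint chosen X (N : nat) : vertex b -> option (vertex a) :=
  match N with
  | 0%N => fun v => if v == [::] then Some [::] else None
  | N'.+1 => fun v =>
      if `[< v = map q (target N') /\ discovered X (chosen X N') (target N') >]
      then Some (target N') else chosen X N' v
  end.

(** A fixed frog above each site stands for it as long as no frog is kept there, so
    that a full family of walks is defined at every step. *)
Definition default v : vertex a := map l v.

Definition representative X N v : vertex a := odflt (default v) (chosen X N v).

Definition limit_representative X v : vertex a :=
  xget (default v) [set r | exists N, chosen X N v = Some r].

Lemma default_lifts v : map q (default v) = v.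
Proof. by rewrite -map_comp; apply: map_id_in => j _ /=; rewrite lK. Qed.

Lemma chosen_lifts X N v r : chosen X N v = Some r -> map q r = v.
Proof.
elim: N => [|N IHN] /=; first by case: eqP => // -> [<-].
by case: asboolP => // -[-> _] [<-].
Qed.

Lemma representative_lifts X N v : map q (representative X N v) = v.
Proof.
rewrite /representative; case E: chosen => [r|] /=; first exact: chosen_lifts E.
exact: default_lifts.
Qed.

Lemma chosen_mono X N M v r :
  (N <= M)%N -> chosen X N v = Some r -> chosen X M v = Some r.
Proof.
move=> /subnK <- Nv; elim: (M - N)%N => //= n IHn.
by case: asboolP => // -[vw [+ _]]; rewrite -vw IHn.
Qed.

Lemma limit_representative_chosen X N v r :
  chosen X N v = Some r -> limit_representative X v = r.
Proof.
move=> Nv; rewrite /limit_representative; case: xgetP => [r' _ [M Mv]|/(_ r)[]].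
  have := chosen_mono (leq_maxr N M) Mv.
  by rewrite (chosen_mono (leq_maxl N M) Nv) => -[].
by exists N.
Qed.

Lemma representative_eventually X v : exists N, forall n, (N <= n)%N ->
  representative X n v = limit_representative X v.
Proof.
have [[N [r Nv]]|none] := pselect (exists N r, chosen X N v = Some r).
  exists N => n Nn; rewrite /representative (chosen_mono Nn Nv) /=.
  by rewrite (limit_representative_chosen Nv).
have chN n : chosen X n v = None.
  by case E: chosen => [r|//]; case: none; exists n, r.
exists 0%N => n _; rewrite /representative chN /limit_representative.
by case: xgetP => // r _ [N]; rewrite chN.
Qed.

Lemma chosen_awake X N v r :
  chosen X N v = Some r -> exists t, moves X t r = Some 0%N.
Proof.
elim: N v r => [|N IHN] v r /=.
  by case: eqP => // _ [<-]; exists 0%N.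
case: asboolP => [[_ [_ [v' [r' [k [chr' Xr']]]]]] [<-]|_]; last exact: IHN.
have [t tr'] := IHN _ _ chr'; rewrite -Xr'.
exact: moves_visit (moves_addn k tr').
Qed.

Definition projected_paths X v (k : nat) : vertex b :=
  map q (X (limit_representative X v) k).

(** A vertex visited by a kept frog becomes the target again at a later step, and is
    kept then unless another frog above the same site has been kept before. *)
Lemma awake_chosen X t v k :
  moves (projected_paths X) t v = Some k -> exists N r, chosen X N v = Some r.
Proof.
elim: t v k => [|t IHt] v k /=.
  by case: eqP => // -> _; exists 0%N, [::].
case E: moves => [k'|]; first by move=> _; exact: IHt E.
case: asboolP => // -[u [n [tu uv]]] _.
have [M [r Mu]] := IHt _ _ tu.
move: uv; rewrite /projected_paths (limit_representative_chosen Mu) => uv.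
have [N MN NX] := target_recurs (X r n.+1) M.
case F: (chosen X N v) => [r'|]; first by exists N, r'.
exists N.+1, (target N); rewrite /= asboolT// NX uv; split=> //; split=> //.
  by rewrite uv.
by exists u, r, n; split => //; exact: chosen_mono Mu.
Qed.

(** The visits to the root after [k] moves correspond for a site and for its kept
    frog; only the waking times differ. *)
Lemma projected_root_visits X (R : realType) :
  total_root_visits (projected_paths X) R = +oo%E ->
  total_root_visits X R = +oo%E.
Proof.
rewrite /total_root_visits /counting.
case: asboolP => // infinite _; case: asboolP => // finX; case: infinite.
pose wake v := xget 0%N [set t | moves (projected_paths X) t v = Some 0%N].
pose g (tw : nat * vertex a) : nat * vertex b :=
  ((wake (map q tw.2) + odflt 0 (moves X tw.1 tw.2))%N, map q tw.2).
apply: (@sub_finite_set _ _ (g @` root_visits X)); last exact: finite_image.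
move=> [t v] [k /= [tv vroot]].
have [N [r Nv]] := awake_chosen tv.
have [t' t'r] := chosen_awake Nv.
have t'kr := moves_addn k t'r.
exists ((t' + k)%N, r).
  exists k; split => //=.
  move: vroot; rewrite /projected_paths (limit_representative_chosen Nv).
  by case: (X r k).
have [t0 tE t0v] := moves_wake tv.
rewrite /g /= t'kr /= (chosen_lifts Nv) tE; congr ((_ + _)%N, _).
rewrite /wake; case: xgetP => [t1 _ t1v|/(_ t0)//].
exact: wake_unique t1v t0v.
Qed.

End Exploration.

(** * The law of the kept frogs *)

Section ProjectedFamily.
Context {disp : measure_display} {T : measurableType disp} {R : realType}.
Variable P : probability T R.
Variables (a b c : nat) (q : 'I_a -> 'I_b) (l : 'I_b -> 'I_a).
Hypothesis c_gt0 : (0 < c)%N.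
Hypothesis fibreq : forall j, #|[pred i | q i == j]| = c.
Hypothesis lK : cancel l q.
Variables (p : R) (S : vertex a -> nat -> T -> vertex a).
Hypothesis frogS : frog_walks P p S.

Definition paths_at (x : T) (w : vertex a) (k : nat) : vertex a := S w k x.

Definition selected (N : nat) (v : vertex b) (n : nat) (x : T) : vertex b :=
  map q (S (representative q l (paths_at x) N v) n x).

Definition limit_selected (v : vertex b) (n : nat) (x : T) : vertex b :=
  projected_paths q l (paths_at x) v n.

Let mS w n u : measurable [set x | S w n x = u].
Proof. by case: frogS => + _ => /(_ w) []. Qed.

Lemma walk_sigma_algebra_project (X : nat -> T -> vertex a) :
  walk_sigma_algebra (project q X) `<=` walk_sigma_algebra X.
Proof.
apply: smallest_sub; first exact: smallest_sigma_algebra.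
move=> _ [n [u ->]].
pose TX := g_sigma_algebraType
  [set A | exists n u, A = [set x | X n x = u]].
apply: (@project_measurable _ TX _ _ q X) => m z.
by apply: sub_sigma_algebra; exists m, z.
Qed.

(** The sigma-algebra generated by [outside J] is the information carried by the
    frogs that are not above [J]. *)
Definition outside (J : set (vertex b)) : set (set T) :=
  \bigcup_(w in [set w | ~ J (map q w)]) walk_sigma_algebra (S w).

Definition unchosen (J : set (vertex b)) (N : nat) (x : T) : Prop :=
  forall u, J u -> chosen q (paths_at x) N u = None.

Lemma outside_walk J w A :
  ~ J (map q w) -> walk_sigma_algebra (S w) A -> <<s outside J >> A.
Proof. by move=> Jw SA; apply: sub_sigma_algebra; exists w. Qed.

Section Measurability.
Variables (J : set (vertex b)).
Let TJ := g_sigma_algebraType (outside J).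

Lemma unchosen_discovered_measurable N w :
  (forall v o, <<s outside J >>
     [set x | unchosen J N x /\ chosen q (paths_at x) N v = o]) ->
  <<s outside J >> [set x | unchosen J N x /\
    discovered q (paths_at x) (chosen q (paths_at x) N) w].
Proof.
move=> mN.
pose F (i : seq 'I_b * seq 'I_a * nat) : set T :=
  [set x | unchosen J N x /\ chosen q (paths_at x) N i.1.1 = Some i.1.2]
    `&` [set x | S i.1.2 i.2.+1 x = w].
rewrite (_ : [set x | _] =
    [set x | unchosen J N x /\ chosen q (paths_at x) N (map q w) = None]
    `&` \bigcup_i F i); last first.
  apply/seteqP; split=> [x [uJ [wN [v [r [k [vr rw]]]]]]|].
    by split=> //; exists (v, r, k).
  by move=> x [[uJ wN] [[[v r] k] _ [[_ vr] rw]]]; do 2!split => //; exists v, r, k.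
apply: (@measurableI _ TJ); first exact: mN.
apply: (@countable_bigcupT_measurable _ TJ); first exact: countableP.
move=> [[v r] k]; rewrite /F /=.
(* a kept frog above J contradicts unchosen J N *)
have [Jr|Jr] := pselect (J (map q r)).
  rewrite [X in measurable X](_ : _ = set0); first exact: (@measurable0 _ TJ).
  apply/seteqP; split => // x [[uJ vr] _].
  by have := uJ _ Jr; rewrite (chosen_lifts vr) vr.
apply: (@measurableI _ TJ); first exact: mN.
by apply: outside_walk Jr _; apply: sub_sigma_algebra; exists k.+1, w.
Qed.

(** As long as no frog above [J] is kept, the exploration has not looked at the
    trajectory of any of them. *)
Lemma unchosen_chosen_measurable N v o : <<s outside J >>
  [set x | unchosen J N x /\ chosen q (paths_at x) N v = o].
Proof.
have mconst (Q : Prop) : <<s outside J >> [set _ : T | Q].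
  have [HQ|HQ] := pselect Q.
    rewrite (_ : [set _ | _] = setT); first exact: (@measurableT _ TJ).
    by apply/seteqP; split.
  rewrite (_ : [set _ | _] = set0); first exact: (@measurable0 _ TJ).
  by apply/seteqP; split.
elim: N v o => [|N IHN] v o; first exact: (mconst
  (unchosen J 0 point /\ chosen q (paths_at point) 0 v = o)).
have mD := unchosen_discovered_measurable (target a N) IHN.
set D := [set x | _ /\ discovered _ _ _ _] in mD.
set w := target a N in D mD.
have stepE x v' : chosen q (paths_at x) N.+1 v' =
  if `[< v' = map q w /\
         discovered q (paths_at x) (chosen q (paths_at x) N) w >]
  then Some w else chosen q (paths_at x) N v' by [].
set A := [set x | unchosen J N x /\ chosen q (paths_at x) N v = o].
have mA : <<s outside J >> A by exact: IHN.
have [Jw|Jw] := pselect (J (map q w)).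
  rewrite (_ : [set x | _] = A `\` D); first exact: (@measurableD _ TJ).
  apply/seteqP; split=> [x [uJ vo]|x [[uJ vo] nD]].
    have ndisc : ~ discovered q (paths_at x) (chosen q (paths_at x) N) w.
      by move=> dw; have := uJ _ Jw; rewrite stepE asboolT.
    have step0 v' : chosen q (paths_at x) N.+1 v' = chosen q (paths_at x) N v'.
      by rewrite stepE asboolF// => -[].
    split; first by split=> [u /uJ|]; rewrite -step0.
    by move=> [].
  have step0 v' : chosen q (paths_at x) N.+1 v' = chosen q (paths_at x) N v'.
    by rewrite stepE asboolF// => -[_ dw]; apply: nD.
  by split=> [u /uJ|]; rewrite step0.
have uJE x : unchosen J N.+1 x <-> unchosen J N x.
  have stepJ u : J u ->
      chosen q (paths_at x) N.+1 u = chosen q (paths_at x) N u.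
    by move=> Ju; rewrite stepE asboolF// => -[uw _]; rewrite uw in Ju.
  by split=> uJ u Ju; have := uJ u Ju; rewrite stepJ.
have [vw|vw] := pselect (v = map q w).
  rewrite (_ : [set x | _] = (D `&` [set _ | Some w = o]) `|` (A `\` D)).
    apply: (@measurableU _ TJ); last exact: (@measurableD _ TJ).
    by apply: (@measurableI _ TJ) => //; exact: mconst.
  apply/seteqP; split=> [x [/uJE uJ]|x [[[uJ dw] wo]|[[uJ vo] nD]]].
  - rewrite stepE; case: asboolP => [[_ dw] wo|nd vo]; first by left.
    by right; split=> // -[_ dw]; apply: nd.
  - by split; [exact/uJE|rewrite stepE asboolT].
  - split; first exact/uJE.
    by rewrite stepE asboolF// => -[_ dw]; apply: nD.
rewrite (_ : [set x | _] = A)//; apply/seteqP; split=> x [uJ vo].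
  by split; [exact/uJE|move: vo; rewrite stepE asboolF// => -[]].
by split; [exact/uJE|rewrite stepE asboolF// => -[]].
Qed.

Lemma unchosen_selected_measurable N v B : ~ J v -> <<s cylinders >> B ->
  <<s outside J >> [set x | unchosen J N x /\ B (trajectory (selected N v) x)].
Proof.
move=> Jv cB.
pose F (o : option (seq 'I_a)) : set T :=
  [set x | unchosen J N x /\ chosen q (paths_at x) N v = o]
    `&` (trajectory (project q (S (odflt (default l v) o))) @^-1` B).
rewrite (_ : [set x | _] = \bigcup_o F o); last first.
  apply/seteqP; split=> [x [uJ Bx]|x [y _ [[uJ vo] Bx]]].
    by exists (chosen q (paths_at x) N v).
  by split => //; rewrite -vo in Bx.
apply: (@countable_bigcupT_measurable _ TJ); first exact: countableP.
move=> o; rewrite /F.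
have [ov|ov] := pselect (map q (odflt (default l v) o) = v); last first.
  rewrite [X in measurable X](_ : _ = set0); first exact: (@measurable0 _ TJ).
  apply/seteqP; split => // x [[_ vo] _]; apply: ov; rewrite -vo.
  exact: representative_lifts.
apply: (@measurableI _ TJ); first exact: unchosen_chosen_measurable.
apply: (outside_walk (w := odflt (default l v) o)); first by rewrite ov.
by apply: walk_sigma_algebra_project; exact: trajectory_preimage.
Qed.

End Measurability.

Lemma outside_measurable J : <<s outside J >> `<=` measurable.
Proof.
apply: smallest_sub; first exact: sigma_algebra_measurable.
by move=> A [w _]; exact: walk_sigma_algebra_measurable.
Qed.

Lemma selected_measurable N v B : <<s cylinders >> B ->
  measurable (trajectory (selected N v) @^-1` B).
Proof.
move=> cB; apply: (@outside_measurable set0).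
rewrite (_ : _ @^-1` _ = [set x | unchosen set0 N x /\
    B (trajectory (selected N v) x)]).
  by apply: unchosen_selected_measurable => //; case.
apply/seteqP; split=> [x Bx|x [_ Bx]]; last exact: Bx.
by split=> // u [].
Qed.

Definition law (v : vertex b) (B : set (nat -> vertex b)) : \bar R :=
  P (trajectory (project q (S (default l v))) @^-1` B).

Lemma same_law w B : <<s cylinders >> B ->
  P (trajectory (project q (S w)) @^-1` B) = law (map q w) B.
Proof.
case: frogS => walkS _; apply: same_prefix_law.
- exact: project_measurable.
- exact: project_measurable.
- move=> n u.
  have [_ ->] := project_biased_walk c_gt0 fibreq (walkS w).
  have [_ ->] := project_biased_walk c_gt0 fibreq (walkS (default l (map q w))).
  by rewrite default_lifts.
Qed.

Lemma independent_outside w u A C : map q w = u ->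
  walk_sigma_algebra (S w) A -> <<s outside [set u] >> C ->
  P (A `&` C) = (P A * P C)%E.
Proof.
case: frogS => _ indS wu SA sC.
apply: (indep_block (i := w) (J := [set w | ~ [set u] (map q w)]) _ _ _ indS).
- by move=> w'; exact: walk_sigma_algebra_measurable.
- by move=> w'; exact: walk_sigma_algebraT.
- by move=> w'; exact: walk_sigma_algebraI.
- by move=> /=; apply; exact: wu.
- exact: SA.
- exact: sC.
Qed.

Lemma selected_step N v : v <> map q (target a N) ->
  selected N.+1 v = selected N v.
Proof.
move=> vw; apply/funext => n; apply/funext => x.
by rewrite /selected /representative /= asboolF// => -[].
Qed.

(** Discovering the target [w] of step [N] replaces one frog above the site
    [u = map q w] by another one. The discovery, and the trajectories selected
    at the other sites, are determined by the frogs outside the fibre of [u], so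
    both frogs are independent of them and may be exchanged. *)
Lemma selected_exchange N (s : seq (vertex b)) B : uniq s ->
  (forall v, <<s cylinders >> (B v)) ->
  P (\bigcap_(v in [set` s]) (trajectory (selected N.+1 v) @^-1` B v)) =
  P (\bigcap_(v in [set` s]) (trajectory (selected N v) @^-1` B v)).
Proof.
move=> us cB; set w := target a N; set u : vertex b := map q w.
have [su|nsu] := boolP (u \in s); last first.
  congr (P _); apply: eq_bigcapr => v /= vs; rewrite selected_step//.
  by move=> vu; rewrite vu (negbTE nsu) in vs.
set E1 := \bigcap_(_ in _) _; set E0 := \bigcap_(_ in _) _.
pose D := [set x | discovered q (paths_at x) (chosen q (paths_at x) N) w].
pose C := D `&` \bigcap_(v in [set` rem u s])
  (trajectory (selected N v) @^-1` B v).
have DE : D = [set x | unchosen [set u] N x /\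
    discovered q (paths_at x) (chosen q (paths_at x) N) w].
  by apply/seteqP; split=> [x dw|x []//]; split=> // _ ->; case: dw.
have sD : <<s outside [set u] >> D.
  rewrite DE; apply: unchosen_discovered_measurable => v o.
  exact: unchosen_chosen_measurable.
have sC : <<s outside [set u] >> C.
  rewrite (_ : C = D `&` \bigcap_(v in [set` rem u s])
      [set x | unchosen [set u] N x /\ B v (trajectory (selected N v) x)]).
    apply: (@measurableI _ (g_sigma_algebraType _)) => //.
    apply: (@fin_bigcap_measurable _ (g_sigma_algebraType _)) => // v.
    rewrite /= mem_rem_uniq// inE => /andP[/eqP vu _].
    exact: unchosen_selected_measurable.
  apply/seteqP; split=> x [Dx Bx]; split=> // v vs; have := Bx v vs; last by case.
  by split=> //; move: Dx; rewrite DE => -[].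
have memE v : v \in s -> v <> u -> v \in rem u s.
  by move=> vs /eqP vu; rewrite mem_rem_uniq// inE vu.
have memE' v : v \in rem u s -> v \in s /\ v <> u.
  by rewrite mem_rem_uniq// inE => /andP[/eqP].
have mE n : measurable (\bigcap_(v in [set` s])
    (trajectory (selected n v) @^-1` B v)).
  by apply: fin_bigcap_measurable => // v _; exact: selected_measurable.
have mD : measurable D by exact: outside_measurable sD.
(* after the discovery the site u is represented by w *)
have E1D : E1 `&` D = trajectory (project q (S w)) @^-1` B u `&` C.
  have repD x : D x -> representative q l (paths_at x) N.+1 u = w.
    by move=> Dx; rewrite /representative /= asboolT.
  apply/seteqP; split=> [x [Ex Dx]|x [Bu [Dx Cx]]].
    split.
      have := Ex u su; rewrite /= /trajectory /selected.
      by under eq_fun do rewrite (repD _ Dx).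
    by split=> // v /memE'[vs vu]; have := Ex v vs; rewrite /= selected_step.
  split=> // v vs; have [->|vu] := pselect (v = u).
    rewrite /= /trajectory /selected.
    by under eq_fun do rewrite (repD _ Dx).
  by rewrite selected_step//; exact/Cx/memE.
(* before it u is represented by its default frog *)
have E0D : E0 `&` D = trajectory (project q (S (default l u))) @^-1` B u `&` C.
  have repD x : D x -> representative q l (paths_at x) N u = default l u.
    by move=> [uN _]; rewrite /representative uN.
  apply/seteqP; split=> [x [Ex Dx]|x [Bu [Dx Cx]]].
    split.
      have := Ex u su; rewrite /= /trajectory /selected.
      by under eq_fun do rewrite (repD _ Dx).
    by split=> // v /memE'[vs vu]; exact: Ex v vs.
  split=> // v vs; have [->|vu] := pselect (v = u).
    rewrite /= /trajectory /selected.
    by under eq_fun do rewrite (repD _ Dx).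
  exact/Cx/memE.
have ED : E1 `\` D = E0 `\` D.
  have trajE x v : ~ D x ->
      trajectory (selected N.+1 v) x = trajectory (selected N v) x.
    move=> nD; apply/funext => n.
    by rewrite /trajectory /selected /representative /= asboolF// => -[_ /nD].
  by apply/seteqP; split=> x [Ex nD]; split=> // v vs; have := Ex v vs;
    rewrite /= trajE.
have split_D A : measurable A -> P A = (P (A `\` D) + P (A `&` D))%E.
  by move=> mA; exact: measureDI.
rewrite (split_D _ (mE N.+1)) (split_D _ (mE N)) -/E1 -/E0 ED E1D E0D.
have sw w' : walk_sigma_algebra (S w')
    (trajectory (project q (S w')) @^-1` B u).
  by apply: walk_sigma_algebra_project; exact: trajectory_preimage.
rewrite (independent_outside erefl (sw w) sC).
rewrite (independent_outside (default_lifts lK u) (sw _) sC).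
by rewrite same_law.
Qed.

Lemma selected_law N (s : seq (vertex b)) B : uniq s ->
  (forall v, <<s cylinders >> (B v)) ->
  P (\bigcap_(v in [set` s]) (trajectory (selected N v) @^-1` B v)) =
  (\prod_(v <- s) fine (law v (B v)))%:E.
Proof.
move=> us cB; elim: N => [|N <-]; last exact: selected_exchange.
have rep0 X v : representative q l X 0 v = default l v.
  by rewrite /representative /=; case: eqP => // ->.
have dinj : injective (default l : seq 'I_b -> seq 'I_a).
  by move=> v v' vv'; rewrite -(default_lifts lK v) vv' default_lifts.
case: frogS => _ indS.
pose A w := trajectory (project q (S w)) @^-1` B (map q w).
transitivity (P (\bigcap_(w in [set` map (default l) s : seq (seq 'I_a)]) A w)).
  congr (P _); rewrite /A /trajectory /selected.
  apply/seteqP; split=> [x Bx _ /mapP[v vs ->]|x Ax v vs].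
    by have := Bx v vs; rewrite /= default_lifts//; under eq_fun do rewrite rep0.
  have := Ax (default l v); rewrite /= map_f// default_lifts// => /(_ isT).
  by under [in X in _ -> X]eq_fun do rewrite rep0.
rewrite indS.
- rewrite big_map; congr (_%:E); apply: eq_bigr => v _.
  by rewrite /A default_lifts.
- by rewrite map_inj_uniq.
- by move=> w _; apply: walk_sigma_algebra_project; exact: trajectory_preimage.
Qed.

(** At each point of the probability space and each site, the representative is
    constant from some step on. *)
Lemma limit_selected_law (s : seq (vertex b)) B : uniq s ->
  (forall v, <<s cylinders >> (B v)) ->
  measurable (\bigcap_(v in [set` s]) (trajectory (limit_selected v) @^-1` B v))
  /\ P (\bigcap_(v in [set` s]) (trajectory (limit_selected v) @^-1` B v)) =
     (\prod_(v <- s) fine (law v (B v)))%:E.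
Proof.
move=> us cB.
apply: (eventually_constant_prob (A := fun N => \bigcap_(v in [set` s])
  (trajectory (selected N v) @^-1` B v))).
- by move=> N; apply: fin_bigcap_measurable => // v _; exact: selected_measurable.
- move=> x.
  have [N repN] : exists N, forall n, (N <= n)%N -> forall v, v \in s ->
      representative q l (paths_at x) n v =
      limit_representative q l (paths_at x) v.
    elim: s {us} => [|v s [N repN]]; first by exists 0%N.
    have [M repM] := representative_eventually q l (paths_at x) v.
    exists (maxn N M) => n; rewrite geq_max => /andP[Nn Mn] u.
    by rewrite inE => /predU1P[->|]; [exact: repM|exact: repN].
  exists N => n Nn.
  have selE v : v \in s -> trajectory (selected n v) x
      = trajectory (limit_selected v) x.
    move=> vs; apply/funext => k.
    by rewrite /trajectory /selected /limit_selected /projected_paths repN.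
  by split=> Bx v vs; have := Bx v vs; rewrite /= selE.
- by move=> N; exact: selected_law.
Qed.

Lemma limit_selected_law1 v B : <<s cylinders >> B ->
  measurable (trajectory (limit_selected v) @^-1` B) /\
  P (trajectory (limit_selected v) @^-1` B) = law v B.
Proof.
move=> cB; have := @limit_selected_law [:: v] (fun=> B) isT (fun=> cB).
rewrite set_cons1 bigcap_set1 big_seq1 => -[mB ->]; split=> //.
rewrite /law fineK// fin_num_measure//.
apply: walk_sigma_algebra_measurable; last exact: trajectory_preimage.
exact: project_measurable.
Qed.

Lemma limit_selected_frog_walks : frog_walks P p limit_selected.
Proof.
have [walkS _] := frogS.
split=> [v|s A us walkA].
  split=> [n u|n u].
    suff /limit_selected_law1-/(_ v)[] : <<s cylinders >>
      [set f : nat -> vertex b | f n = u] by [].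
    by apply: sub_sigma_algebra; exists n, u.
  have /limit_selected_law1-/(_ v)[_] : <<s cylinders >>
      [set f : nat -> vertex b | forall k, (k <= n)%N -> f k = u k].
    rewrite (_ : [set f | _] = setT `\` \bigcup_k
      (if (k <= n)%N then setT `\` [set f | f k = u k] else set0)).
      apply: sigma_algebraCD; apply: sigma_algebra_bigcup => k.
      case: ifP => _; last exact: sigma_algebra0.
      by apply: sigma_algebraCD; apply: sub_sigma_algebra; exists k, (u k).
    apply/seteqP; split=> [f fu|f [_ fu] k kn].
      by split=> // -[k _]; case: ifP => // kn [_]; apply; exact: fu.
    by apply: contrapT => fk; apply: fu; exists k => //; rewrite kn.
  rewrite /law /trajectory /preimage /= => ->.
  have [_ ->] := project_biased_walk c_gt0 fibreq (walkS (default l v)).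
  by rewrite default_lifts.
have /choice[B HB] : forall v, exists B, <<s cylinders >> B /\
    (v \in s -> A v = trajectory (limit_selected v) @^-1` B).
  move=> v; have [vs|_] := boolP (v \in s).
    by have [B cB AB] := walk_sigma_algebra_preimage (walkA v vs); exists B.
  by exists set0; split => //; exact: sigma_algebra0.
have AE : \bigcap_(v in [set` s]) A v =
    \bigcap_(v in [set` s]) (trajectory (limit_selected v) @^-1` B v).
  by apply: eq_bigcapr => v vs; apply: (HB v).2.
rewrite AE (limit_selected_law us (fun v => (HB v).1)).2.
congr (_%:E); apply: eq_big_seq => v vs.
by rewrite ((HB v).2 vs) (limit_selected_law1 v (HB v).1).2.
Qed.

End ProjectedFamily.

(** * Monotonicity and convergence *)

Lemma recurrent_lift (R : realType) (a b c : nat) (q : 'I_a -> 'I_b)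
    (l : 'I_b -> 'I_a) (p : R) :
  (0 < c)%N -> (forall j, #|[pred i | q i == j]| = c) -> cancel l q ->
  recurrent b p -> recurrent a p.
Proof.
move=> c_gt0 fibreq lK rec_b disp T P S frogS.
have := rec_b disp T P _ (limit_selected_frog_walks c_gt0 fibreq lK frogS).
by apply: filterS => x; exact: projected_root_visits.
Qed.

Lemma equitable_letter_map (c b : nat) : (0 < c)%N ->
  exists (q : 'I_(c * b) -> 'I_b) (l : 'I_b -> 'I_(c * b)),
    (forall j, #|[pred i | q i == j]| = c) /\ cancel l q.
Proof.
case: c => // c _.
have cardE : #|{: 'I_c.+1 * 'I_b}| = (c.+1 * b)%N by rewrite card_prod !card_ord.
pose h (i : 'I_(c.+1 * b)) : 'I_c.+1 * 'I_b := enum_val (cast_ord (esym cardE) i).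
pose g (x : 'I_c.+1 * 'I_b) : 'I_(c.+1 * b) := cast_ord cardE (enum_rank x).
have hK : cancel h g by move=> i; rewrite /g /h enum_valK cast_ordKV.
have gK : cancel g h by move=> x; rewrite /g /h cast_ordK enum_rankK.
exists (fun i => (h i).2), (fun j => g (ord0, j)); split=> [j|j]; last by rewrite gK.
rewrite -[RHS]card_ord -(card_codom (f := fun k => g (k, j))); last first.
  by move=> k k' /(can_inj gK) [].
apply: eq_card => i; rewrite inE; apply/eqP/codomP => [<-|[k ->]].
  by exists (h i).1; rewrite -surjective_pairing hK.
by rewrite gK.
Qed.

Lemma recurrent_mul (R : realType) (c b : nat) (p : R) : (0 < c)%N ->
  recurrent b p -> recurrent (c * b) p.
Proof.
move=> c_gt0; have [q [l [fibreq lK]]] := equitable_letter_map b c_gt0.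
exact: recurrent_lift c_gt0 fibreq lK.
Qed.

(** If some set is non-empty the infima eventually decrease; if all are empty
    they all take the conventional value of the infimum of the empty set. *)
Lemma increasing_sets_inf_cvg (R : realType) (A : nat -> set R) :
  (forall k, A k `<=` A k.+1) -> (forall k x, A k x -> 0 <= x) ->
  exists l : R, (fun k => inf (A k)) @ \oo --> l.
Proof.
move=> subA A_ge0.
have subA_le m n : (m <= n)%N -> A m `<=` A n.
  by move=> /subnK <-; elim: (n - m)%N => // k IHk x /IHk; exact: subA.
have [[K [x0 AK]]|empty] := pselect (exists K, A K !=set0); last first.
  exists (inf set0); rewrite (_ : (fun k => _) = fun=> inf set0); first exact: cvg_cst.
  apply/funext => k; congr inf; apply/seteqP; split=> // x Akx.
  by case: empty; exists k, x.
have An0 n : A (n + K)%N !=set0 by exists x0; apply: subA_le AK; exact: leq_addl.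
have lbA n : lbound (A n) 0 by move=> x; exact: A_ge0.
suff : cvgn (fun n => inf (A (n + K)%N)).
  move=> /cvg_ex [l cv]; exists l.
  by rewrite -(cvg_shiftn K (fun k => inf (A k))).
apply: nonincreasing_is_cvgn.
  move=> m n mn; apply: lb_le_inf => // x Ax.
  apply: ge_inf; first by exists 0.
  by apply: subA_le Ax; rewrite leq_add2r.
by exists 0 => _ [n _ <-]; exact: lb_le_inf.
Qed.

Theorem mainTheorem3 (R : realType) (d : nat) (hd : (2 <= d)%N) :
  exists pstar : R,
    (fun k : nat => critical_drift R (d ^ k.+1)) @ \oo --> pstar.
Proof.
apply: increasing_sets_inf_cvg => [k p [p01 rec]|k p [/andP[]//]].
by split=> //; rewrite expnS; apply: recurrent_mul => //; exact: ltnW hd.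
Qed.
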